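(* Let $\varphi:=f\circ e+g$, where $f:\mathbb{R}^m\to\mathbb{R}$ is a closed convex function, $g\in\Gamma_0(\mathbb{R}^n)$, and $e:\mathbb{R}^n\to\mathbb{R}^m$ is a smooth mapping with Jacobian $\nabla e(x)$. Let $\varphi$ satisfy the composite EB condition with positive constants $\mu,L$ obeying $\mu<L$. Assume that $\varphi$ achieves its minimum $\min\varphi$, so that $\mathrm{Arg}\min\varphi\ne\emptyset$. Then there exists a unique vector $x^*$ such that $\mathrm{Arg}\min\varphi=\{x^*\}$, and Nesterov's accelerated forward-backward method converges Q-linearly in the sense that there exists a positive constant $\theta_0<1$ such that for any $\theta\in[\theta_0,1)$ it holds $$\Phi_{k+1}(x^*;\tau)\le\rho\cdot\Phi_k(x^*;\tau),\quad k\ge0,$$ where $\rho=\max\{\alpha,\theta\}<1$ and $\tau=\frac{\theta\beta}{2\rho\gamma}$. Especially, by taking $\theta=\max\{\theta_0,\alpha\}$, we have $$\Phi_{k+1}\left(x^*;\frac{2L\mu}{(\sqrt L+\sqrt\mu)^2}\right)\le\max\{\theta_0,\alpha\}\cdot\Phi_k\left(x^*;\frac{2L\mu}{(\sqrt L+\sqrt\mu)^2}\right),\quad k\ge0.$$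
   Context: $\Gamma_0(\mathbb{R}^n)$ is the class of proper lower semicontinuous convex functions $\mathbb{R}^n\to(-\infty,+\infty]$; $\mathrm{Arg}\min\varphi$ is the set of minimizers of $\varphi$ over $\mathbb{R}^n$. For $L>0$ let $$\ell(x;y)=g(x)+f(e(y)+\nabla e(y)(x-y))+\frac L2\|x-y\|^2,\quad p(y)=\arg\min_{x\in\mathbb{R}^n}\ell(x;y),\quad G(y)=L(y-p(y)).$$ $\varphi$ satisfies the composite EB condition with positive constants $\mu,L$ obeying $\mu<L$ if for all $x,y\in\mathbb{R}^n$, $$\langle G(y),y-x\rangle\ge\varphi(p(y))-\varphi(x)+\frac1{2L}\|G(y)\|^2+\frac\mu2\|x-y\|^2.$$ Nesterov's accelerated forward-backward method: choose $x_{-1}=x_0\in\mathbb{R}^n$ and for $k\ge0$, $$y_k=x_k+\frac{\sqrt L-\sqrt\mu}{\sqrt L+\sqrt\mu}(x_k-x_{k-1}),\qquad x_{k+1}=y_k-\frac1LG(y_k).$$ Constants: $\alpha=\frac{\sqrt L-\sqrt\mu}{\sqrt L+\sqrt\mu}$, $\beta=\frac{2\sqrt\mu}{\sqrt L+\sqrt\mu}$, $\gamma=\frac1{2L}\left(1+\sqrt{\frac L\mu}\right)$. For $k\ge0$: $z_k=\frac12\left(1+\sqrt{\frac L\mu}\right)y_k+\frac12\left(1-\sqrt{\frac L\mu}\right)x_k$ and $\Phi_k(x^*;\tau)=\varphi(x_k)-\min\varphi+\tau\|z_k-x^*\|^2$. *)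

(* Defs.v *)
From mathcomp Require Import all_boot all_order all_algebra.
From mathcomp Require Import all_classical all_reals all_analysis.

Set Implicit Arguments.
Unset Strict Implicit.
Unset Printing Implicit Defensive.

Import Order.TTheory GRing.Theory Num.Theory.
Import numFieldNormedType.Exports.

Local Open Scope classical_set_scope.
Local Open Scope ring_scope.

(* Vectors of R^n are row vectors, as required by the library's [jacobian]:
   the Jacobian at y applied to v is [v *m 'J e y].  The library norm on
   ['rV[R]_n] is the sup norm, so the Euclidean structure is given here; it
   induces the same topology. *)
Definition dotv (R : realType) (n : nat) (u v : 'rV[R]_n) : R :=
  \sum_(i < n) u ord0 i * v ord0 i.

Definition sqnorm (R : realType) (n : nat) (u : 'rV[R]_n) : R := dotv u u.

Definition argmin (T : Type) (R : realType) (h : T -> \bar R) : set T :=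
  [set x | forall y, (h x <= h y)%E].

Definition minval (T : Type) (R : realType) (h : T -> \bar R) : \bar R :=
  ereal_inf (range h).

(* In [\bar R], [0 * +oo = 0], so the endpoints t = 0 and t = 1 are harmless. *)
Definition econvex (R : realType) (n : nat) (h : 'rV[R]_n -> \bar R) : Prop :=
  forall (x y : 'rV[R]_n) (t : R), 0 <= t <= 1 ->
    (h (t *: x + (1 - t) *: y)%R <= t%:E * h x + (1 - t)%:E * h y)%E.

Definition Gamma0 (R : realType) (n : nat) (h : 'rV[R]_n -> \bar R) : Prop :=
  [/\ forall x, h x <> -oo%E, exists x, h x <> +oo%E,
      lower_semicontinuous h & econvex h].

(* For a finite-valued convex function, closed means lower semicontinuous. *)
Definition closed_convex (R : realType) (m : nat) (f : 'rV[R]_m -> R) : Prop :=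
  lower_semicontinuous (fun x => (f x)%:E) /\
  convex_function [set: convex_lmodType 'rV[R]_m]
    (f : convex_lmodType 'rV[R]_m -> R^o).

Definition smooth_map (R : realType) (n m : nat)
    (e : 'rV[R]_n -> 'rV[R]_m) : Prop :=
  (forall x, differentiable e x) /\ continuous (fun x => 'J e x).

Section ForwardBackward.
Context {R : realType} {n m : nat}.
Context (f : 'rV[R]_m -> R) (g : 'rV[R]_n -> \bar R) (e : 'rV[R]_n -> 'rV[R]_m).
Context (mu L : R).

Definition phi (x : 'rV[R]_n) : \bar R := ((f (e x))%:E + g x)%E.

Definition ell (y x : 'rV[R]_n) : \bar R :=
  (g x + (f (e y + (x - y) *m 'J e y)%R)%:E + (L / 2 * sqnorm (x - y))%:E)%E.

(* For convex f, g in Gamma0 and L > 0, [ell y] is proper, lower semicontinuous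
   and strongly convex, so [argmin (ell y)] is a singleton and the default
   value of [xget] is never used. *)
Definition prox (y : 'rV[R]_n) : 'rV[R]_n := xget 0 (argmin (ell y)).

Definition grad_map (y : 'rV[R]_n) : 'rV[R]_n := L *: (y - prox y).

(* [phi (prox y)] is always finite, so no indeterminate form +oo - +oo occurs;
   the inequality is void where [phi x = +oo]. *)
Definition composite_EB : Prop := forall x y : 'rV[R]_n,
  ((dotv (grad_map y) (y - x))%:E >=
     phi (prox y) - phi x + ((2 * L)^-1 * sqnorm (grad_map y))%:E
       + (mu / 2 * sqnorm (x - y))%:E)%E.

Definition nest_alpha : R :=
  (Num.sqrt L - Num.sqrt mu) / (Num.sqrt L + Num.sqrt mu).

Definition nest_beta : R := 2 * Num.sqrt mu / (Num.sqrt L + Num.sqrt mu).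

Definition nest_gamma : R := (2 * L)^-1 * (1 + Num.sqrt (L / mu)).

Definition extrapolate (xprev x : 'rV[R]_n) : 'rV[R]_n :=
  x + nest_alpha *: (x - xprev).

(* [nest_state x0 k] is the pair $(x_{k-1}, x_k)$, with $x_{-1} = x_0$. *)
Fixpoint nest_state (x0 : 'rV[R]_n) (k : nat) : 'rV[R]_n * 'rV[R]_n :=
  if k is k'.+1 then
    let: (xprev, x) := nest_state x0 k' in
    let y := extrapolate xprev x in
    (x, y - L^-1 *: grad_map y)
  else (x0, x0).

Definition nest_x (x0 : 'rV[R]_n) (k : nat) : 'rV[R]_n := (nest_state x0 k).2.

Definition nest_y (x0 : 'rV[R]_n) (k : nat) : 'rV[R]_n :=
  extrapolate (nest_state x0 k).1 (nest_state x0 k).2.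

Definition nest_z (x0 : 'rV[R]_n) (k : nat) : 'rV[R]_n :=
  (2^-1 * (1 + Num.sqrt (L / mu))) *: nest_y x0 k
  + (2^-1 * (1 - Num.sqrt (L / mu))) *: nest_x x0 k.

Definition Phi (x0 : 'rV[R]_n) (k : nat) (xstar : 'rV[R]_n) (tau : R) : \bar R :=
  (phi (nest_x x0 k) - minval phi + (tau * sqnorm (nest_z x0 k - xstar))%:E)%E.

End ForwardBackward.

(* Main.v *)
Require Import Defs.
From mathcomp Require Import all_boot all_order all_algebra.
From mathcomp Require Import all_classical all_reals all_analysis.
From mathcomp Require Import ring lra.

Import Order.TTheory GRing.Theory Num.Theory.
Import numFieldNormedType.Exports.

Local Open Scope classical_set_scope.
Local Open Scope ring_scope.

(** Write [F] for [phi], [x+ = prox y] and [G = grad_map y = L (y - x+)].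

    The error bound at [y] compares [F (x+)] with [F x] for every [x] at once.
    At [x = y = x*] with [x*] a minimizer it forces [G = 0], hence [x+ = x*];
    at [y = x*] it then says that [F] grows quadratically away from [x*]
    ([quadratic_growth]), so the minimizer is unique.

    For the rate, the error bound at [y = y_k] is used twice, with [x = x_k]
    and with [x = x*], and the two inequalities are averaged with the weights
    [alpha] and [beta = 1 - alpha].  The point [z_k] is designed so that
    [beta z_k = y_k - alpha x_k] ([nest_zE]) and [z_(k+1) = z_k - gamma G]
    ([nest_zS]).  Expanding [|z_(k+1) - x*|^2] therefore produces exactly the
    inner product [<G, z_k - x*>] of the averaged inequality, and for
    [tau = beta / (2 gamma)], thanks to [beta gamma L = 1], both the inner
    product and the [|G|^2] terms cancel.  What remains beyond
    [alpha (F x_k - min F) + tau |z_k - x*|^2] is the gain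
    [- mu/2 (alpha |y_k - x_k|^2 + beta |y_k - x*|^2)], which by convexity of
    the square is at most [- mu/2 beta^2 |z_k - x*|^2] ([energy_step]).  As
    [mu beta^2 / (2 tau) = mu / L], the energy contracts by the factor
    [max (alpha, 1 - mu / L) = 1 - mu / L].  With [theta0 = 1 - mu / L], every
    admissible [theta] dominates [alpha], so that [rho = theta] and [tau] does
    not depend on [theta]. *)

(** * Euclidean identities *)

Section Euclidean.
Set Implicit Arguments.
Unset Strict Implicit.
Context {R : realType} {n : nat}.
Implicit Types u v w : 'rV[R]_n.

Lemma sqnorm_ge0 u : 0 <= sqnorm u.
Proof. by apply: sumr_ge0 => i _; rewrite -expr2 sqr_ge0. Qed.

Lemma sqnorm_eq0 u : sqnorm u = 0 -> u = 0.
Proof.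
move=> /eqP; rewrite psumr_eq0; last by move=> i _; rewrite -expr2 sqr_ge0.
move=> /allP u0; apply/rowP => i; rewrite mxE.
by have := u0 i (mem_index_enum _); rewrite /= -expr2 sqrf_eq0 => /eqP.
Qed.

Lemma sqnorm0 : sqnorm (0 : 'rV[R]_n) = 0.
Proof. by apply: big1 => i _; rewrite mxE mul0r. Qed.

Lemma dotv0r u : dotv u 0 = 0.
Proof. by apply: big1 => i _; rewrite mxE mulr0. Qed.

Lemma dot0v u : dotv 0 u = 0.
Proof. by apply: big1 => i _; rewrite mxE mul0r. Qed.

Lemma dotvDr u v w : dotv u (v + w) = dotv u v + dotv u w.
Proof.
by rewrite -big_split; apply: eq_bigr => i _; rewrite /= mxE mulrDr.
Qed.

Lemma dotvZr (c : R) u v : dotv u (c *: v) = c * dotv u v.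
Proof. by rewrite mulr_sumr; apply: eq_bigr => i _; rewrite mxE; ring. Qed.

Lemma sqnormZ (c : R) u : sqnorm (c *: u) = c ^+ 2 * sqnorm u.
Proof. by rewrite mulr_sumr; apply: eq_bigr => i _; rewrite mxE; ring. Qed.

Lemma sqnorm_distC u v : sqnorm (u - v) = sqnorm (v - u).
Proof. by apply: eq_bigr => i _; rewrite !mxE; ring. Qed.

Lemma sqnormBZ (c : R) u v :
  sqnorm (u - c *: v) = sqnorm u - 2 * c * dotv v u + c ^+ 2 * sqnorm v.
Proof.
rewrite /sqnorm /dotv !mulr_sumr -sumrN -!big_split.
by apply: eq_bigr => i _; rewrite /= !mxE; ring.
Qed.

Lemma sqnorm_convex (a b : R) u v : 0 <= a -> 0 <= b -> a + b = 1 ->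
  sqnorm (a *: u + b *: v) <= a * sqnorm u + b * sqnorm v.
Proof.
move=> a0 b0 ab1; rewrite /sqnorm /dotv !mulr_sumr -big_split.
apply: ler_sum => i _; rewrite /= !mxE -subr_ge0.
set p := u ord0 i; set q := v ord0 i; have -> : b = 1 - a by lra.
(* the defect of convexity of the square *)
have -> : a * (p * p) + (1 - a) * (q * q)
    - (a * p + (1 - a) * q) * (a * p + (1 - a) * q)
    = a * (1 - a) * (p - q) ^+ 2 by ring.
by rewrite mulr_ge0 ?sqr_ge0// mulr_ge0//; lra.
Qed.

(** One step of the method, stripped of the function: [Fx], [Fp], [Fs] stand
    for its values at [x], at the proximal point of [y] and at the minimizer
    [xs], and the two hypotheses on [Fp] are instances of the error bound.  The
    relation [b * c * L = 1] is what cancels the terms in [sqnorm G]. *)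
Lemma energy_step (a b c mu L Fx Fp Fs : R) (x y z xs G : 'rV[R]_n) :
  0 <= a -> 0 < b -> a + b = 1 -> 0 < c -> 0 < L -> b * c * L = 1 -> 0 <= mu ->
  b *: z = y - a *: x ->
  Fp - Fx + (2 * L)^-1 * sqnorm G + mu / 2 * sqnorm (x - y) <= dotv G (y - x) ->
  Fp - Fs + (2 * L)^-1 * sqnorm G + mu / 2 * sqnorm (xs - y)
    <= dotv G (y - xs) ->
  Fp - Fs + b / (2 * c) * sqnorm (z - c *: G - xs)
    <= a * (Fx - Fs) + (b / (2 * c) - mu / 2 * b ^+ 2) * sqnorm (z - xs).
Proof.
move=> a0 b0 ab1 c0 L0 bcL mu0 zE EBx EBs.
have bzE : b *: (z - xs) = a *: (y - x) + b *: (y - xs).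
  rewrite scalerBr zE; apply/rowP => i; rewrite !mxE.
  have -> : a = 1 - b by lra.
  by ring.
have dotE : b * dotv G (z - xs) = a * dotv G (y - x) + b * dotv G (y - xs).
  by rewrite -!dotvZr -dotvDr bzE.
have gain : b ^+ 2 * sqnorm (z - xs)
    <= a * sqnorm (x - y) + b * sqnorm (xs - y).
  rewrite -sqnormZ bzE [sqnorm (x - y)]sqnorm_distC.
  rewrite [sqnorm (xs - y)]sqnorm_distC.
  by apply: sqnorm_convex => //; exact: ltW.
have -> : z - c *: G - xs = (z - xs) - c *: G by rewrite addrAC.
rewrite sqnormBZ.
have -> : (b / (2 * c)) * (sqnorm (z - xs) - 2 * c * dotv G (z - xs)
      + c ^+ 2 * sqnorm G)
    = b / (2 * c) * sqnorm (z - xs) - b * dotv G (z - xs)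
      + b * c / 2 * sqnorm G by field; rewrite gt_eqF.
have -> : b * c / 2 = (2 * L)^-1.
  have -> : b * c = L^-1 by rewrite -[RHS]mul1r -bcL mulfK ?gt_eqF.
  by field; rewrite gt_eqF.
rewrite dotE mulrBl.
have EBx' := ler_wpM2l a0 EBx.
have EBs' := ler_wpM2l (ltW b0) EBs.
have gain' := ler_wpM2l (divr_ge0 mu0 (ler0n _ 2)) gain.
have bE : b = 1 - a by lra.
rewrite bE in EBs' gain' *.
move: EBx' EBs' gain'.
set P := sqnorm G; set Q := (2 * L)^-1 * P.
set D1 := dotv G _; set D2 := dotv G _.
set S1 := sqnorm _; set S2 := sqnorm _; set S3 := sqnorm _.
by lra.
Qed.

End Euclidean.

(** * Constants of the method *)

Section Constants.
Set Implicit Arguments.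
Unset Strict Implicit.
Context {R : realType} {mu L : R}.
Hypotheses (mu_gt0 : 0 < mu) (mu_lt_L : mu < L).

Let s := Num.sqrt mu.
Let r := Num.sqrt L.
Let L_gt0 : 0 < L. Proof. exact: lt_trans mu_lt_L. Qed.
Let s_gt0 : 0 < s. Proof. by rewrite sqrtr_gt0. Qed.
Let s_lt_r : s < r. Proof. by rewrite ltr_sqrt. Qed.
Let r_gt0 : 0 < r. Proof. exact: lt_trans s_lt_r. Qed.
Let sD_gt0 : 0 < r + s. Proof. exact: addr_gt0. Qed.
Let muE : mu = s ^+ 2. Proof. by rewrite sqr_sqrtr// ltW. Qed.
Let LE : L = r ^+ 2. Proof. by rewrite sqr_sqrtr// ltW. Qed.

Lemma sqrt_div_ratio : Num.sqrt (L / mu) = r / s.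
Proof. by rewrite sqrtrM ?ltW// sqrtrV ?ltW. Qed.

Lemma nest_alpha_gt0 : 0 < nest_alpha mu L.
Proof. by rewrite divr_gt0// subr_gt0. Qed.

Lemma nest_beta_gt0 : 0 < nest_beta mu L.
Proof. by rewrite divr_gt0// mulr_gt0. Qed.

Lemma nest_gamma_gt0 : 0 < nest_gamma mu L.
Proof.
by rewrite mulr_gt0 ?invr_gt0 ?mulr_gt0// ltr_pwDl// sqrtr_ge0.
Qed.

Lemma nest_alphaDbeta : nest_alpha mu L + nest_beta mu L = 1.
Proof.
by rewrite /nest_alpha /nest_beta -/s -/r; field; rewrite gt_eqF.
Qed.

Lemma nest_beta_gammaL : nest_beta mu L * nest_gamma mu L * L = 1.
Proof.
rewrite /nest_beta /nest_gamma sqrt_div_ratio -/s -/r LE.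
by field; rewrite !gt_eqF.
Qed.

Lemma nest_tauE : nest_beta mu L / (2 * nest_gamma mu L)
  = 2 * L * mu / (Num.sqrt L + Num.sqrt mu) ^+ 2.
Proof.
rewrite /nest_beta /nest_gamma sqrt_div_ratio -/s -/r LE muE.
by field; rewrite !gt_eqF// addrC.
Qed.

Lemma nest_gainE : nest_beta mu L / (2 * nest_gamma mu L)
    - mu / 2 * nest_beta mu L ^+ 2
  = (1 - mu / L) * (nest_beta mu L / (2 * nest_gamma mu L)).
Proof.
rewrite /nest_beta /nest_gamma sqrt_div_ratio -/s -/r LE muE.
by field; rewrite !gt_eqF// addrC.
Qed.

(** With [q = sqrt (mu / L)], this is [(1 - q) / (1 + q) <= (1 - q) (1 + q)]. *)
Lemma nest_alpha_le : nest_alpha mu L <= 1 - mu / L.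
Proof.
rewrite /nest_alpha -/s -/r muE LE -subr_ge0.
have -> : 1 - s ^+ 2 / r ^+ 2 - (r - s) / (r + s)
    = (r - s) * s * (2 * r + s) / (r ^+ 2 * (r + s)).
  by field; rewrite !gt_eqF.
rewrite divr_ge0// ?mulr_ge0 ?exprn_ge0 ?subr_ge0 ?addr_ge0 ?mulr_ge0 ?ltW//.
Qed.

End Constants.

(** * The error bound at finite points and the minimizer *)

Section Method.
Set Implicit Arguments.
Unset Strict Implicit.
Context {R : realType} {n m : nat}.
Context {f : 'rV[R]_m -> R} {g : 'rV[R]_n -> \bar R}.
Context {e : 'rV[R]_n -> 'rV[R]_m} {mu L : R}.
Hypothesis g_neqNy : forall x, g x <> -oo%E.
Hypotheses (mu_gt0 : 0 < mu) (mu_lt_L : mu < L).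
Hypothesis EB : composite_EB f g e mu L.

Let L_gt0 : 0 < L. Proof. exact: lt_trans mu_lt_L. Qed.

Notation F := (phi f g e).
Notation G := (grad_map f g e L).
Notation p := (prox f g e L).

Lemma phi_neqNy x : F x <> -oo%E.
Proof. by rewrite /phi; have := @g_neqNy x; case: (g x). Qed.

Lemma phi_fin_or_pinfty x : F x = +oo%E \/ exists a : R, F x = a%:E.
Proof.
by have := @phi_neqNy x; case: (F x) => [a|//|//] _; [right; exists a|left].
Qed.

(** An infinite value at the proximal point would make the right-hand side of
    the error bound infinite, so finiteness at one [x] yields finiteness
    there. *)
Lemma EB_fin x y (a : R) : F x = a%:E -> exists2 b : R, F (p y) = b%:E &
  b - a + (2 * L)^-1 * sqnorm (G y) + mu / 2 * sqnorm (x - y)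
    <= dotv (G y) (y - x).
Proof.
move=> Fx; have := EB x y; rewrite Fx.
have [->//|[b ->]] := phi_fin_or_pinfty (p y).
by rewrite -EFinB -!EFinD lee_fin => EBxy; exists b.
Qed.

Lemma phi_argmin_fin xs : (exists x, g x <> +oo%E) -> argmin F xs ->
  exists a : R, F xs = a%:E.
Proof.
move=> [x gx] /(_ x); have [->|//] := phi_fin_or_pinfty xs.
have [Fx _|[a ->]//] := phi_fin_or_pinfty x.
by case: gx; move: Fx; rewrite /phi; case: (g x).
Qed.

(** At [x = y = xs] the right-hand side of the error bound is a sum of
    nonnegative terms and its left-hand side is zero. *)
Lemma prox_argmin xs (a : R) : F xs = a%:E -> argmin F xs -> p xs = xs.
Proof.
move=> Fxs min_xs; have [b Fp EBxs] := EB_fin xs Fxs.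
have ab : a <= b by have := min_xs (p xs); rewrite Fp Fxs lee_fin.
move: EBxs; rewrite !subrr sqnorm0 dotv0r mulr0 addr0 => EBxs.
have G0 : G xs = 0.
  apply: sqnorm_eq0; apply/eqP; rewrite eq_le sqnorm_ge0 andbT.
  have : (2 * L)^-1 * sqnorm (G xs) <= 0 by lra.
  by rewrite pmulr_rle0// invr_gt0 mulr_gt0.
move/eqP: G0; rewrite /grad_map scaler_eq0 gt_eqF//= subr_eq0.
by move=> /eqP.
Qed.

Lemma quadratic_growth xs x (a c : R) : F xs = a%:E -> argmin F xs ->
  F x = c%:E -> a + mu / 2 * sqnorm (x - xs) <= c.
Proof.
move=> Fxs min_xs Fx; have [b] := EB_fin xs Fx.
have pxs := prox_argmin Fxs min_xs.
rewrite /grad_map pxs Fxs => -[<-].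
by rewrite subrr scaler0 sqnorm0 dot0v mulr0; lra.
Qed.

Lemma argmin_phi_unique xs (a : R) : F xs = a%:E -> argmin F xs ->
  argmin F = [set xs].
Proof.
move=> Fxs min_xs; apply/seteqP; split=> [x min_x|x ->//].
have := min_x xs; rewrite Fxs.
have [->//|[c Fx]] := phi_fin_or_pinfty x; rewrite Fx lee_fin => ca.
have growth := quadratic_growth Fxs min_xs Fx.
apply/eqP; rewrite -subr_eq0; apply/eqP/sqnorm_eq0/eqP.
rewrite eq_le sqnorm_ge0 andbT.
have : mu / 2 * sqnorm (x - xs) <= 0 by lra.
by rewrite pmulr_rle0// divr_gt0.
Qed.

Lemma minval_argmin xs : argmin F xs -> minval F = F xs.
Proof.
move=> min_xs; apply/eqP; rewrite eq_le; apply/andP; split.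
- by apply: ereal_inf_lbound; exists xs.
- by apply: le_ereal_inf_tmp => _ [x _ <-]; exact: min_xs.
Qed.

(** * The auxiliary sequence and the contraction *)

Notation X := (nest_x f g e mu L).
Notation Y := (nest_y f g e mu L).
Notation Z := (nest_z f g e mu L).

Lemma nest_xS x0 k : X x0 k.+1 = Y x0 k - L^-1 *: G (Y x0 k).
Proof. by rewrite /nest_x /nest_y /=; case: nest_state. Qed.

Lemma nest_x_prox x0 k : X x0 k.+1 = p (Y x0 k).
Proof.
by rewrite nest_xS /grad_map scalerA mulVf ?gt_eqF// scale1r opprB addrC subrK.
Qed.

Lemma nest_yS x0 k :
  Y x0 k.+1 = X x0 k.+1 + nest_alpha mu L *: (X x0 k.+1 - X x0 k).
Proof. by rewrite /nest_x /nest_y /=; case: nest_state. Qed.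

(** So [z_k] is the affine combination [(y_k - alpha x_k) / (1 - alpha)]: it
    lies on the line through [x_k] and [y_k], beyond [y_k]. *)
Lemma nest_zE x0 k :
  nest_beta mu L *: Z x0 k = Y x0 k - nest_alpha mu L *: X x0 k.
Proof.
have s_gt0 : 0 < Num.sqrt mu by rewrite sqrtr_gt0.
have r_gt0 : 0 < Num.sqrt L by rewrite sqrtr_gt0.
rewrite /nest_z /nest_alpha /nest_beta (sqrt_div_ratio mu_gt0 mu_lt_L).
by apply/rowP => i; rewrite !mxE; field; rewrite !gt_eqF// addr_gt0.
Qed.

(** The extrapolation parameter makes [y_(k+1) - alpha x_(k+1)] equal to
    [x_(k+1) - alpha x_k], so the momentum disappears and [z] merely takes a
    gradient step, of length [gamma = 1 / (beta L)]. *)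
Lemma nest_zS x0 k :
  Z x0 k.+1 = Z x0 k - nest_gamma mu L *: G (Y x0 k).
Proof.
have b_neq0 : nest_beta mu L != 0 by rewrite gt_eqF// nest_beta_gt0.
apply: (scalerI b_neq0); rewrite scalerBr !nest_zE nest_yS nest_xS.
rewrite [nest_beta mu L *: (_ *: _)]scalerA.
have -> : nest_beta mu L * nest_gamma mu L = L^-1.
  by rewrite -[RHS]mul1r -(nest_beta_gammaL mu_gt0 mu_lt_L) mulfK ?gt_eqF.
by apply/rowP => i; rewrite !mxE; ring.
Qed.

(** [energy_step] with the constants of the method: the function gap contracts
    by [alpha] and the distance term by [1 - mu / L], the larger of the two.
    Only an infinite [phi (X x0 k)], possible for [k = 0], escapes it, and then
    the right-hand side is [+oo]. *)
Lemma Phi_contraction xs x0 k (th : R) :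
  (exists x, g x <> +oo%E) -> argmin F xs -> 1 - mu / L <= th ->
  let tau := nest_beta mu L / (2 * nest_gamma mu L) in
  (Phi f g e mu L x0 k.+1 xs tau <= th%:E * Phi f g e mu L x0 k xs tau)%E.
Proof.
move=> g_dom min_xs th_ge /=; set tau := _ / _.
have muL_lt1 : mu / L < 1 by rewrite ltr_pdivrMr// mul1r.
have th_gt0 : 0 < th by lra.
have [a Fxs] := phi_argmin_fin g_dom min_xs.
rewrite /Phi (minval_argmin min_xs) Fxs nest_x_prox.
have [b Fp EBs] := EB_fin (Y x0 k) Fxs; rewrite Fp.
have [->|[c Fx]] := phi_fin_or_pinfty (X x0 k).
  by rewrite /= gt0_muley ?lte_fin// leey.
have [b'] := EB_fin (Y x0 k) Fx; rewrite Fp => -[<-] EBx.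
rewrite Fx -!EFinB -!EFinD -EFinM lee_fin nest_zS.
have tau_gt0 : 0 < tau.
  apply: divr_gt0; first exact: nest_beta_gt0.
  by apply: mulr_gt0 => //; exact: nest_gamma_gt0.
have ac : a <= c by have := min_xs (X x0 k); rewrite Fxs Fx lee_fin.
apply: (le_trans (energy_step (ltW (nest_alpha_gt0 mu_gt0 mu_lt_L))
  (nest_beta_gt0 mu_gt0 mu_lt_L) (nest_alphaDbeta mu_gt0 mu_lt_L)
  (nest_gamma_gt0 mu_gt0 mu_lt_L) L_gt0 (nest_beta_gammaL mu_gt0 mu_lt_L)
  (ltW mu_gt0) (nest_zE x0 k) EBx EBs)).
rewrite (nest_gainE mu_gt0 mu_lt_L) -/tau [th * _]mulrDr [th * (tau * _)]mulrA.
apply: lerD.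
- rewrite ler_wpM2r ?subr_ge0//.
  by apply: le_trans th_ge; exact: nest_alpha_le.
- by rewrite ler_wpM2r ?sqnorm_ge0// ler_wpM2r// ltW.
Qed.

End Method.

Theorem theorem4 (R : realType) (n m : nat)
    (f : 'rV[R]_m -> R) (g : 'rV[R]_n -> \bar R) (e : 'rV[R]_n -> 'rV[R]_m)
    (mu L : R)
    (hf : closed_convex f) (hg : Gamma0 g) (he : smooth_map e)
    (mu_gt0 : 0 < mu) (L_gt0 : 0 < L) (mu_lt_L : mu < L)
    (hEB : composite_EB f g e mu L)
    (hmin : argmin (phi f g e) !=set0) :
  exists xstar : 'rV[R]_n,
    unique (fun x => argmin (phi f g e) = [set x]) xstar /\
    exists theta0 : R,
      [/\ 0 < theta0, theta0 < 1,
        forall theta : R, theta0 <= theta -> theta < 1 ->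
          let rho := Num.max (nest_alpha mu L) theta in
          let tau := theta * nest_beta mu L / (2 * rho * nest_gamma mu L) in
          rho < 1 /\
          forall (x0 : 'rV[R]_n) (k : nat),
            (Phi f g e mu L x0 k.+1 xstar tau
               <= rho%:E * Phi f g e mu L x0 k xstar tau)%E
      & let tau := 2 * L * mu / (Num.sqrt L + Num.sqrt mu) ^+ 2 in
        forall (x0 : 'rV[R]_n) (k : nat),
          (Phi f g e mu L x0 k.+1 xstar tau
             <= (Num.max theta0 (nest_alpha mu L))%:E
                * Phi f g e mu L x0 k xstar tau)%E].
Proof.
have [g_neqNy g_dom _ _] := hg; have [xs min_xs] := hmin.
have [a Fxs] := phi_argmin_fin g_neqNy g_dom min_xs.
have argminE := argmin_phi_unique g_neqNy mu_gt0 mu_lt_L hEB Fxs min_xs.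
have alpha_le := nest_alpha_le mu_gt0 mu_lt_L.
have muL_lt1 : mu / L < 1 by rewrite ltr_pdivrMr// mul1r.
have muL_gt0 : 0 < mu / L by rewrite divr_gt0.
exists xs; split.
  split=> // x argminE'.
  by have : argmin (phi f g e) xs by []; rewrite argminE'.
exists (1 - mu / L); split; [by lra|by lra| |].
- move=> th th_ge th_lt1 rho tau.
  have rhoE : rho = th by apply/max_idPr; exact: le_trans th_ge.
  split; first by rewrite rhoE.
  move=> x0 k.
  have -> : tau = nest_beta mu L / (2 * nest_gamma mu L).
    rewrite /tau rhoE; field.
    by rewrite !gt_eqF ?nest_gamma_gt0//; lra.
  by rewrite rhoE; exact: Phi_contraction.
- move=> tau x0 k; rewrite /tau -(nest_tauE mu_gt0 mu_lt_L).
  have /max_idPl -> := alpha_le.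
  exact: Phi_contraction.
Qed.
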